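(* Let $H$ be a separable Hilbert space, let $(X,\mu)$ be a $\sigma$-finite measure space, let $F:X\to H$ be a continuous near-Riesz basis for $H$ with respect to $(X,\mu)$, and let $U:H\to H$ be an invertible bounded linear operator (with bounded inverse). Then $UF:X\to H$, $x\mapsto U(F(x))$, is also a continuous near-Riesz basis for $H$.
   Context: Measures are positive. A mapping $F:X\to H$ is weakly measurable if $x\mapsto\langle f,F(x)\rangle$ is measurable for every $f\in H$. Continuous frame: a weakly measurable $F:X\to H$ for which there are constants $A,B>0$ with $A\|f\|^2\le\int_X|\langle f,F(x)\rangle|^2\,d\mu(x)\le B\|f\|^2$ for all $f\in H$. Bessel mapping: a weakly measurable $F$ for which the upper inequality holds for some $B>0$. $\mu$-complete: a Bessel mapping $F:X\to H$ is $\mu$-complete if $\left\{\int_X\phi(x)F(x)\,d\mu(x) : \phi\in L^2(X,\mu)\right\}$ is dense in $H$, the integrals being understood in the weak sense. For a measurable subset $Y\subseteq X$, these notions are applied to the restriction $F|_Y$ using the measure $\mu$ restricted to $Y$. Continuous Riesz basis: $F:X\to H$ is a continuous Riesz basis for $H$ with respect to $(X,\mu)$ if $F$ is $\mu$-complete and there are constants $A,B>0$ such that for every $\phi\in L^2(X,\mu)$ and every measurable $X_1\subseteq X$ with $\mu(X_1)<\infty$, $$A\left(\int_{X_1}|\phi(x)|^2\,d\mu(x)\right)^{1/2}\le\left\|\int_{X_1}\phi(x)F(x)\,d\mu(x)\right\|\le B\left(\int_{X_1}|\phi(x)|^2\,d\mu(x)\right)^{1/2}$$ (integrals in the weak sense).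 Continuous near-Riesz basis: a continuous frame $F:X\to H$ such that (i) there is a measurable subset $X_1\subset X$ with $0<\mu(X_1)<\infty$ such that $\{F(x) : x\in X\setminus X_1\}$ is a continuous Riesz basis for $H$ (with respect to $\mu$ restricted to $X\setminus X_1$); and (ii) if $\mu(X)=\infty$, then for every measurable $Y\subset X$ with $\mu(Y)<\infty$, the restriction $F|_Y$ is not $\mu$-complete. *)

(* Defs.v *)
From HB Require Import structures.
From mathcomp Require Import all_boot all_order all_algebra.
From mathcomp Require Import complex.
From mathcomp Require Import all_classical all_reals all_analysis.

Set Implicit Arguments.
Unset Strict Implicit.
Unset Printing Implicit Defensive.

Import Order.TTheory GRing.Theory Num.Theory.
Import numFieldNormedType.Exports.

Local Open Scope classical_set_scope.
Local Open Scope ring_scope.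

(* A Hilbert space is real or complex: its scalar field is [scalars R k]. *)
Variant scalar_kind := RealScalars | ComplexScalars.

Definition scalars (R : realType) (k : scalar_kind) : numFieldType :=
  match k with RealScalars => R | ComplexScalars => R[i] end.

Definition re (R : realType) (k : scalar_kind) : scalars R k -> R :=
  match k with RealScalars => id | ComplexScalars => @complex.Re R end.

Definition im (R : realType) (k : scalar_kind) : scalars R k -> R :=
  match k with RealScalars => fun=> 0 | ComplexScalars => @complex.Im R end.

Definition conj (R : realType) (k : scalar_kind) :
    scalars R k -> scalars R k :=
  match k with RealScalars => id | ComplexScalars => @conjc R end.

(* The norm takes its values in [scalars R k]; this is the same norm with
   values in [R]. *)
Definition rnorm (R : realType) (k : scalar_kind)
  (V : normedZmodType (scalars R k)) (v : V) : R := re `|v|.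

Definition separable_space (T : topologicalType) : Prop :=
  exists2 S : set T, countable S & dense S.

Definition bounded_operator (K : numFieldType) (V W : normedModType K)
    (f : V -> W) : Prop :=
  exists M : K, forall v, `|f v| <= M * `|v|.

Definition boundedly_invertible (K : numFieldType) (V W : normedModType K)
    (f : V -> W) : Prop :=
  exists g : {linear W -> V}, [/\ bounded_operator g, cancel f g & cancel g f].

Section scalar_functions.
Context {d : measure_display} {X : measurableType d} {R : realType}
        {k : scalar_kind}.
Implicit Types (mu : {measure set X -> \bar R}) (D : set X)
               (g : X -> scalars R k).

Definition scalar_measurable D g : Prop :=
  measurable_fun D (fun x => re (g x)) /\
  measurable_fun D (fun x => im (g x)).

Definition scalar_integrable mu D g : Prop :=
  mu.-integrable D (fun x => (re (g x))%:E) /\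
  mu.-integrable D (fun x => (im (g x))%:E).

Definition sqnorm_int mu D g : \bar R :=
  (\int[mu]_(x in D) (rnorm (g x) ^+ 2)%:E)%E.

Definition L2 mu D g : Prop :=
  scalar_measurable D g /\ (sqnorm_int mu D g < +oo)%E.

End scalar_functions.

(* Throughout, [D] is a measurable subset of [X], and the notions below are
   those of the restriction of [F] to [D], with [mu] restricted to [D].
   As in [{dot H for _}], the inner product is linear on the left. *)
Section frames.
Context {d : measure_display} {X : measurableType d} {R : realType}
        {k : scalar_kind} {H : completeNormedModType (scalars R k)}.
Variables (mu : {measure set X -> \bar R}) (dot : {dot H for @conj R k}).
Implicit Types (D : set X) (F : X -> H).

Definition weakly_measurable D F : Prop :=
  forall f : H, scalar_measurable D (fun x => dot f (F x)).

Definition bessel_mapping D F : Prop :=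
  weakly_measurable D F /\
  exists2 B : R, 0 < B &
    forall f : H,
      (sqnorm_int mu D (fun x => dot f (F x)) <= (B * rnorm f ^+ 2)%:E)%E.

Definition continuous_frame D F : Prop :=
  weakly_measurable D F /\
  exists A B : R, [/\ 0 < A, 0 < B &
    forall f : H,
      ((A * rnorm f ^+ 2)%:E <= sqnorm_int mu D (fun x => dot f (F x))
         <= (B * rnorm f ^+ 2)%:E)%E].

(* [v] is the weak integral of [G] over [D]; it is unique if it exists, since
   [dot] is definite. The last two equations are the real and imaginary parts
   of <v, h> = \int_D <G x, h>. *)
Definition is_weak_integral D (G : X -> H) (v : H) : Prop :=
  forall h : H,
    [/\ scalar_integrable mu D (fun x => dot (G x) h),
        re (dot v h) = \int[mu]_(x in D) re (dot (G x) h) &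
        im (dot v h) = \int[mu]_(x in D) im (dot (G x) h)].

Definition mu_complete D F : Prop :=
  bessel_mapping D F /\
  dense [set v : H | exists2 phi : X -> scalars R k,
           L2 mu D phi & is_weak_integral D (fun x => phi x *: F x) v].

Definition continuous_riesz_basis D F : Prop :=
  mu_complete D F /\
  exists A B : R, [/\ 0 < A, 0 < B &
    forall (phi : X -> scalars R k) (X1 : set X),
      L2 mu D phi -> measurable X1 -> X1 `<=` D -> (mu X1 < +oo)%E ->
      exists2 v : H, is_weak_integral X1 (fun x => phi x *: F x) v &
        (A%:E * sqrte (sqnorm_int mu X1 phi) <= (rnorm v)%:E
           <= B%:E * sqrte (sqnorm_int mu X1 phi))%E].

Definition continuous_near_riesz_basis F : Prop :=
  [/\ continuous_frame setT F,
      exists X1 : set X,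
        [/\ measurable X1, (0 < mu X1 < +oo)%E &
            continuous_riesz_basis (~` X1) F] &
      mu setT = +oo%E ->
      forall Y : set X, measurable Y -> (mu Y < +oo)%E -> ~ mu_complete Y F].

End frames.

(* Main.v *)
From HB Require Import structures.
Require Import Defs.
From mathcomp Require Import all_boot all_order all_algebra.
From mathcomp Require Import complex lra.
From mathcomp Require Import all_classical all_reals all_analysis.
Set Implicit Arguments.
Unset Strict Implicit.
Unset Printing Implicit Defensive.

Import Order.TTheory GRing.Theory Num.Theory.
Import numFieldNormedType.Exports.
Local Open Scope classical_set_scope.
Local Open Scope ring_scope.

(** A bounded operator [T] on a Hilbert space has an adjoint [Ta], and
    [dot f (T (F x)) = dot (Ta f) (F x)] for all [f] and [x].  Thus every
    function of [x] that enters the definitions for [T \o F] is one that enters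
    them for [F], with [f] replaced by [Ta f], and [Ta] has the same bound as
    [T].  This yields weak measurability and the upper frame bound of [T \o F]
    ([bessel_mapping_op]), and shows that [T] maps a weak integral of [G] to a
    weak integral of [T \o G] ([is_weak_integral_op]).

    Let [V] be a bounded inverse of [T].  Then [`|f| <= N * `|Ta f|], where [N]
    bounds [V], because the adjoint of [V] is a left inverse of [Ta]; this is
    the lower frame bound ([continuous_frame_op]).  The vectors synthesised from
    [T \o F] are the images under [T] of those synthesised from [F], so density
    is preserved, [T] being continuous and onto ([mu_complete_op]), and the
    Riesz bounds change by factors [N^-1] and the bound of [T]
    ([continuous_riesz_basis_op]).  The exceptional set of finite measure is the
    same for [F] and for [U \o F].  Finally, completeness of [U \o F] on a set
    would give, through the inverse of [U], completeness of [F] on that set;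
    hence non-completeness on sets of finite measure is preserved as well.

    The existence of the adjoint rests on the Riesz representation theorem
    ([riesz_representation]): a bounded functional [f] is represented by the
    minimiser of [`|v| ^ 2 - 2 Re (f v)].  A minimising sequence is Cauchy by
    the parallelogram law, and almost minimisers almost represent the real part
    of [f], with an error that vanishes in the limit.  Multiplying the argument
    by scalars then recovers [f] from its real part. *)

(** * Real parts and real scalars *)

Section scalars.
Context {R : realType} {k : scalar_kind}.
Implicit Types (t : R) (a b : scalars R k).

Definition of_real : R -> scalars R k :=
  match k with RealScalars => id | ComplexScalars => @real_complex R end.

Lemma re_of_real t : re (of_real t) = t.
Proof. by rewrite /re /of_real; case: k. Qed.

Lemma reD a b : re (a + b) = re a + re b.
Proof. by rewrite /re; move: a b; case: k => //= -[? ?] [? ?]. Qed.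

Lemma reN a : re (- a) = - re a.
Proof. by rewrite /re; move: a; case: k => //= -[? ?]. Qed.

Lemma re_conj a : re (conj a) = re a.
Proof. by rewrite /re /conj; move: a; case: k => //= -[? ?]. Qed.

Lemma re_of_realM t a : re (of_real t * a) = t * re a.
Proof.
rewrite /re /of_real; move: a; case: k => //= -[x y] /=.
by rewrite mul0r subr0.
Qed.

Lemma ge0_of_real a : 0 <= a -> a = of_real (re a).
Proof.
rewrite /re /of_real; move: a; case: k => //= -[x y].
by rewrite lecE /= => /andP[/eqP-> _].
Qed.

Lemma le_of_real t t' : (of_real t <= of_real t') = (t <= t').
Proof. by rewrite /of_real; case: k => //; exact: lecR. Qed.

Lemma of_realM t t' : of_real (t * t') = of_real t * of_real t'.
Proof. by rewrite /of_real; case: k => //; exact: rmorphM. Qed.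

Lemma lt_of_real t t' : (of_real t < of_real t') = (t < t').
Proof. by rewrite /of_real; case: k => //; exact: ltcR. Qed.

Lemma of_real0 : of_real 0 = 0.
Proof. by rewrite /of_real; case: k. Qed.

Lemma of_real1 : of_real 1 = 1.
Proof. by rewrite /of_real; case: k. Qed.

(** If [a] were nonzero then [b = a^-1] would give real part one. *)
Lemma re_mul_eq0 a : (forall b, re (b * a) = 0) -> a = 0.
Proof.
move=> /(_ a^-1) h; apply/eqP/negP => /negP a0; move: h.
by rewrite mulVf// -of_real1 re_of_real => /eqP; rewrite oner_eq0.
Qed.

Section norm.
Context {V : normedModType (scalars R k)}.
Implicit Types u v : V.

Lemma of_real_rnorm v : of_real (rnorm v) = `|v|.
Proof. by rewrite -ge0_of_real. Qed.

Lemma rnorm_ge0 v : 0 <= rnorm v.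
Proof. by rewrite -le_of_real of_real_rnorm of_real0. Qed.

Lemma rnorm_eq0 v : (rnorm v = 0) -> (v = 0).
Proof. by move=> h; apply/normr0_eq0; rewrite -of_real_rnorm h of_real0. Qed.

Lemma rnormB u v : rnorm (u - v) = rnorm (v - u).
Proof. by rewrite /rnorm distrC. Qed.

End norm.

(** Nothing forces the scalar bound [M] of a bounded operator to be real when
    all vectors are zero, hence its modulus; adding one makes it positive. *)
Lemma bounded_operator_rnorm {V W : normedModType (scalars R k)} (f : V -> W) :
  bounded_operator f ->
  exists2 M : R, 0 < M & forall v, rnorm (f v) <= M * rnorm v.
Proof.
move=> [M hM]; exists (re `|M| + 1) => [|v].
  by rewrite ltr_wpDl// -le_of_real of_real0 -ge0_of_real.
have h : rnorm (f v) <= re `|M| * rnorm v.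
  rewrite -le_of_real of_realM -ge0_of_real// !of_real_rnorm.
  rewrite (le_trans (hM v))// -[X in _ <= _ * X]normr_id -normrM.
  rewrite real_ler_norm//.
  by apply: ger0_real; exact: le_trans (hM v).
by rewrite (le_trans h)// ler_wpM2r ?rnorm_ge0// lerDl.
Qed.

End scalars.

(** * Inner product spaces *)

Section inner_product.
Context {R : realType} {k : scalar_kind} {H : normedModType (scalars R k)}.
Variable dot : {dot H for @conj R k}.
Hypothesis dot_norm : forall v : H, dot v v = `|v| ^+ 2.
Implicit Types (u v h : H) (t : R).

Lemma dotC u v : dot u v = conj (dot v u).
Proof. by rewrite ((@hermitian_subproof _ _ _ _ dot)) expr0 mul1r. Qed.

Lemma re_dotC u v : re (dot u v) = re (dot v u).
Proof. by rewrite dotC re_conj. Qed.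

Lemma re_dotDl u v h : re (dot (u + v) h) = re (dot u h) + re (dot v h).
Proof. by rewrite linearDl reD. Qed.

Lemma re_dotDr u v h : re (dot h (u + v)) = re (dot h u) + re (dot h v).
Proof. by rewrite linearDr reD. Qed.

Lemma re_dotZl t u v : re (dot (of_real t *: u) v) = t * re (dot u v).
Proof. by rewrite linearZl_LR re_of_realM. Qed.

Lemma re_dotZr t u v : re (dot u (of_real t *: v)) = t * re (dot u v).
Proof. by rewrite re_dotC re_dotZl re_dotC. Qed.

Lemma re_dotNr u v : re (dot u (- v)) = - re (dot u v).
Proof. by rewrite linearNr reN. Qed.

Lemma rnorm_sqr v : rnorm v ^+ 2 = re (dot v v).
Proof.
by rewrite dot_norm -of_real_rnorm !expr2 -of_realM re_of_real.
Qed.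

Lemma rnorm_sqrD u v :
  rnorm (u + v) ^+ 2 = rnorm u ^+ 2 + 2 * re (dot u v) + rnorm v ^+ 2.
Proof.
rewrite !rnorm_sqr re_dotDl !re_dotDr (re_dotC v u); lra.
Qed.

Lemma rnorm_sqrZ t v : rnorm (of_real t *: v) ^+ 2 = t ^+ 2 * rnorm v ^+ 2.
Proof. by rewrite !rnorm_sqr re_dotZl re_dotZr expr2 mulrA. Qed.

Lemma rnormN v : rnorm (- v) = rnorm v.
Proof. by rewrite /rnorm normrN. Qed.

Lemma dot_eqr u v : (forall h, dot h u = dot h v) -> u = v.
Proof.
move=> huv; apply/eqP; rewrite -subr_eq0; apply/eqP/rnorm_eq0/eqP.
have := rnorm_sqr (u - v); rewrite linearBr /= huv subrr.
by rewrite -of_real0 re_of_real => /eqP; rewrite sqrf_eq0.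
Qed.

(** Cauchy-Schwarz: expand [0 <= `|b u - a v| ^ 2] where [a] and [b] are the
    norms of [u] and [v]. *)
Lemma re_dot_le u v : re (dot u v) <= rnorm u * rnorm v.
Proof.
have [u0|u0] := eqVneq (rnorm u) 0.
  by rewrite (rnorm_eq0 u0) linear0l -of_real0 re_of_real mulr_ge0 ?rnorm_ge0.
have [v0|v0] := eqVneq (rnorm v) 0.
  by rewrite (rnorm_eq0 v0) linear0r -of_real0 re_of_real mulr_ge0 ?rnorm_ge0.
have p : 0 < rnorm u * rnorm v.
  by rewrite mulr_gt0// lt_neqAle eq_sym ?u0 ?v0 rnorm_ge0.
rewrite -subr_ge0 -(pmulr_rge0 _ p).
have := sqr_ge0 (rnorm (of_real (rnorm v) *: u + of_real (- rnorm u) *: v)).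
rewrite rnorm_sqrD !rnorm_sqrZ re_dotZl re_dotZr; nra.
Qed.

End inner_product.

(** * Riesz representation and adjoints *)

(** Completeness is a statement about entourages indexed by scalars; this is
    the form with real distances, for a rate that minimising sequences have. *)
Lemma cauchy_rnorm_cvg {R : realType} {k : scalar_kind}
    {H : completeNormedModType (scalars R k)} (u : nat -> H) :
  (forall p q, (p <= q)%N -> rnorm (u p - u q) <= 2 / p.+1%:R) ->
  exists w : H, forall e : R, 0 < e ->
    exists n, n.+1%:R^-1 < e /\ rnorm (w - u n) < e.
Proof.
move=> hu.
have small (e : R) : 0 < e -> \forall n \near \oo, n.+1%:R^-1 < e.
  move=> e0; have := near_infty_natSinv_lt (PosNum e0); exact.
have /cauchy_cvgP/cvg_ex[w uw] : cauchy (u @ \oo).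
  apply/cauchy_exP => e e0.
  have e0' : 0 < re e / 2.
    rewrite divr_gt0//; move: (e0); rewrite {1}(ge0_of_real (ltW e0)).
    by rewrite -of_real0 lt_of_real.
  have [N _ hN] := small _ e0'.
  exists (u N); exists N => // n /= Nn; rewrite -ball_normE /=.
  rewrite -of_real_rnorm (ge0_of_real (ltW e0)) lt_of_real.
  rewrite (le_lt_trans (hu _ _ Nn))//.
  have : N.+1%:R^-1 < re e / 2 := hN N (leqnn N).
by rewrite ltr_pdivlMr// mulrC.
exists w => e e0.
have e0' : 0 < of_real e :> scalars R k by rewrite -of_real0 lt_of_real.
have /cvgrPdist_lt/(_ _ e0') h := uw.
have /(_ _)/filter_ex[n [h1 h2]] := filterI h (small e e0).
exists n; split=> //.
by rewrite -(@lt_of_real _ k) of_real_rnorm.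
Qed.

Section riesz.
Context {R : realType} {k : scalar_kind}
        {H : completeNormedModType (scalars R k)}.
Variable dot : {dot H for @conj R k}.
Hypothesis dot_norm : forall v : H, dot v v = `|v| ^+ 2.

(** The representing vector minimises [E v = `|v| ^ 2 - 2 Re (f v)], which
    equals [`|v - w| ^ 2 - `|w| ^ 2] when [w] represents [f].  Boundedness of
    [f] makes [E] bounded below. *)
Lemma riesz_representation (f : {scalar H}) (C : R) :
  (forall v, re (f v) <= C * rnorm v) ->
  exists w : H, forall h, f h = dot h w.
Proof.
move=> fC.
have refD u v : re (f (u + v)) = re (f u) + re (f v) by rewrite linearD reD.
have refZ t v : re (f (of_real t *: v)) = t * re (f v).
  by rewrite linearZ/= re_of_realM.
pose E v : R := rnorm v ^+ 2 - 2 * re (f v).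
have Elb : has_lbound (range E).
  exists (- C ^+ 2) => _ [v _ <-]; rewrite /E.
  by have := fC v; have := sqr_ge0 (rnorm v - C); lra.
have E0 : has_inf (range E) by split => //; exists (E 0), 0.
pose m := inf (range E).
have mE v : m <= E v by apply: ge_inf => //; exists v.
have [u Eu] : exists u : nat -> H, forall n, E (u n) < m + n.+1%:R^-1 ^+ 2.
  suff h : forall n, exists v, E v < m + n.+1%:R^-1 ^+ 2.
    by have [u Eu] := choice h; exists u.
  move=> n.
  have n0 : 0 < (n.+1%:R^-1 : R) ^+ 2 by rewrite exprn_gt0.
  by have [_ [v _ <-]] := inf_adherent n0 E0; exists v.
have /cauchy_rnorm_cvg[w uw] p q : (p <= q)%N ->
    rnorm (u p - u q) <= 2 / p.+1%:R.
  move=> pq.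
  have r_pq : (q.+1%:R^-1 : R) ^+ 2 <= p.+1%:R^-1 ^+ 2.
    by rewrite lerXn2r ?nnegrE// lef_pV2 ?posrE// ler_nat.
  (* parallelogram law: the energy of the midpoint is at least [m], while
     those of [u p] and [u q] exceed [m] by at most the squared rates *)
  have := mE (of_real 2^-1 *: (u p + u q)); have := Eu p; have := Eu q.
  rewrite /E (rnorm_sqrZ dot_norm) refZ refD.
  rewrite (rnorm_sqrD dot_norm) => Eq Ep Emid.
  rewrite -(@ler_pXn2r _ 2) ?nnegrE ?rnorm_ge0 ?divr_ge0// exprMn.
  rewrite (rnorm_sqrD dot_norm) re_dotNr rnormN.
  by move: (p.+1%:R^-1) (q.+1%:R^-1) r_pq Eq Ep Emid => r r' *; lra.
(* first variation with step [1 / (n + 1)]: the step balances the energy gap,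
   which is its square, against the quadratic term *)
have defect n h : 
    - (n.+1%:R^-1 * (1 + rnorm h ^+ 2)) <= 2 * (re (dot (u n) h) - re (f h)).
  have := mE (u n + of_real n.+1%:R^-1 *: h); have := Eu n.
  have n0 : 0 < (n.+1%:R^-1 : R) by [].
  rewrite /E (rnorm_sqrD dot_norm) (rnorm_sqrZ dot_norm) re_dotZr.
  rewrite refD refZ => E1 E2.
  by rewrite -(ler_pM2l n0); move: (n.+1%:R^-1) E1 E2 => r; lra.
have ge h : re (f h) <= re (dot w h).
  apply/ler_addgt0Pr => e e0.
  have h0 : 0 < 1 + rnorm h ^+ 2 by rewrite ltr_pwDl// sqr_ge0.
  have [n [rn wn]] := uw (e / (1 + rnorm h ^+ 2)) (divr_gt0 e0 h0).
  have := defect n h; have := re_dot_le dot_norm (u n - w) h.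
  rewrite re_dotDl linearNl reN rnormB.
  move: rn wn; rewrite !ltr_pdivlMr// => rn wn.
  have := mulr_ge0 (rnorm_ge0 (w - u n)) (sqr_ge0 (rnorm h - 1)).
  by move: (n.+1%:R^-1) rn => r; lra.
have req h : re (f h) = re (dot w h).
  apply/eqP; rewrite eq_le ge/=.
  by have := ge (- h); rewrite re_dotNr linearN reN lerN2.
exists w => h; apply/eqP; rewrite -subr_eq0; apply/eqP/re_mul_eq0 => b.
(* real parts suffice, as [h] may be replaced by [b *: h] *)
have -> : b * (f h - dot h w) = f (b *: h) - dot (b *: h) w.
  by rewrite mulrBr linearZl_LR; congr (_ - _); rewrite linearZ_LR.
by rewrite reD reN req re_dotC subrr.
Qed.

(** Represent the functional [u |-> dot (T u) v] for each [v]. *)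
Lemma adjoint_exists (T : {linear H -> H}) : bounded_operator T ->
  exists Ta : H -> H, forall u v, dot (T u) v = dot u (Ta v).
Proof.
move=> /bounded_operator_rnorm[M _ TM].
suff /choice[Ta TaP] : forall v, exists w, forall u, dot (T u) v = dot u w.
  by exists Ta.
move=> v.
have lin : scalar (fun u => dot (T u) v).
  by move=> a x y; rewrite linearP linearPl.
pose f : {scalar H} := HB.pack (fun u => dot (T u) v)
  (GRing.isLinear.Build _ _ _ _ (fun u => dot (T u) v) lin).
apply: (@riesz_representation f (M * rnorm v)) => u /=.
by rewrite (le_trans (re_dot_le dot_norm _ _))// mulrAC ler_wpM2r ?rnorm_ge0.
Qed.

(** [`|Ta v| ^ 2 = dot (T (Ta v)) v], to which Cauchy-Schwarz applies. *)
Lemma adjoint_rnorm_le (T Ta : H -> H) (M : R) :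
  (forall u v, dot (T u) v = dot u (Ta v)) -> 0 <= M ->
  (forall v, rnorm (T v) <= M * rnorm v) ->
  forall v, rnorm (Ta v) <= M * rnorm v.
Proof.
move=> adj M0 TM v.
have [->|n0] := eqVneq (rnorm (Ta v)) 0; first by rewrite mulr_ge0 ?rnorm_ge0.
have p : 0 < rnorm (Ta v) by rewrite lt_neqAle eq_sym n0 rnorm_ge0.
rewrite -(ler_pM2l p) -expr2 (rnorm_sqr dot_norm) -adj.
rewrite (le_trans (re_dot_le dot_norm _ _))//.
by rewrite mulrCA mulrA ler_wpM2r ?rnorm_ge0.
Qed.

End riesz.

(** * Frames and Riesz bases under an invertible operator *)

Section transport.
Context {R : realType} {k : scalar_kind}
        {H : completeNormedModType (scalars R k)}
        {d : measure_display} {X : measurableType d}.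
Variables (dot : {dot H for @conj R k}) (mu : {measure set X -> \bar R}).
Hypothesis dot_norm : forall v : H, dot v v = `|v| ^+ 2.
Implicit Types (D : set X) (F : X -> H).

Section adjoint.
Variables (T : {linear H -> H}) (Ta : H -> H).
Hypothesis adj : forall u v, dot (T u) v = dot u (Ta v).

Lemma dot_adjoint u v : dot u (T v) = dot (Ta u) v.
Proof. by rewrite dotC adj -dotC. Qed.

Lemma weakly_measurable_op D F :
  weakly_measurable dot D F -> weakly_measurable dot D (T \o F).
Proof.
by move=> mF f; under eq_fun do rewrite dot_adjoint; exact: mF.
Qed.

Lemma sqnorm_int_op D F f :
  sqnorm_int mu D (fun x => dot f (T (F x))) =
  sqnorm_int mu D (fun x => dot (Ta f) (F x)).
Proof. by under eq_fun do rewrite dot_adjoint. Qed.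

(** Testing [T v] against [h] is testing [v] against [Ta h]. *)
Lemma is_weak_integral_op D (G : X -> H) v :
  is_weak_integral mu dot D G v -> is_weak_integral mu dot D (T \o G) (T v).
Proof.
move=> Gv h; have [Gint Gre Gim] := Gv (Ta h); rewrite adj.
split; first by under eq_fun do rewrite /= adj.
- by under eq_Rintegral do rewrite /= adj.
- by under eq_Rintegral do rewrite /= adj.
Qed.

Lemma is_weak_integral_scale_op D F (phi : X -> scalars R k) v :
  is_weak_integral mu dot D (fun x => phi x *: F x) v ->
  is_weak_integral mu dot D (fun x => phi x *: T (F x)) (T v).
Proof.
move=> /is_weak_integral_op; congr is_weak_integral.
by apply/funext => x /=; rewrite linearZ.
Qed.

End adjoint.

Lemma bounded_operator_continuous (T : {linear H -> H}) :
  bounded_operator T -> continuous T.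
Proof.
move=> /bounded_operator_rnorm[M M0 TM].
apply/linear_bounded_continuous/bounded_funP => r.
exists (of_real M * r) => x xr.
have M0' : 0 <= of_real M :> scalars R k by rewrite -of_real0 le_of_real ltW.
rewrite (le_trans _ (ler_wpM2l M0' xr))//.
by rewrite -!of_real_rnorm -of_realM le_of_real.
Qed.

Lemma bessel_mapping_op (T : {linear H -> H}) D F :
  bounded_operator T ->
  bessel_mapping mu dot D F -> bessel_mapping mu dot D (T \o F).
Proof.
move=> Tb [mF [B B0 FB]]; have [Ta adj] := adjoint_exists dot_norm Tb.
have [M M0 TM] := bounded_operator_rnorm Tb.
have TaM := adjoint_rnorm_le dot_norm adj (ltW M0) TM.
split; first exact: weakly_measurable_op adj _ _ mF.
exists (B * M ^+ 2) => [|f]; first by rewrite mulr_gt0 ?exprn_gt0.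
rewrite (sqnorm_int_op adj) (le_trans (FB _))// lee_fin -mulrA -exprMn.
by rewrite ler_pM2l// lerXn2r ?nnegrE ?mulr_ge0 ?rnorm_ge0// ltW.
Qed.

(** The preimage under [T] of a nonempty open set is open because [T] is
    continuous and nonempty because [T] is onto; a weak integral lying in it is
    sent by [T] into the given open set. *)
Lemma mu_complete_op (T V : {linear H -> H}) D F :
  bounded_operator T -> cancel V T ->
  mu_complete mu dot D F -> mu_complete mu dot D (T \o F).
Proof.
move=> Tb VK [Fb Fd]; split; first exact: bessel_mapping_op.
have [Ta adj] := adjoint_exists dot_norm Tb.
move=> O [y Oy] oO.
have [||v [/= OTv [phi phiL2 phiv]]] := Fd (T @^-1` O).
- by exists (V y); rewrite /= VK.
- by move: oO; apply: open_comp => x _; exact: bounded_operator_continuous.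
- exists (T v); split => //; exists phi => //.
  exact: is_weak_integral_scale_op adj _ _ _ _ phiv.
Qed.

(** For the lower bound, [Va \o Ta] is the adjoint of [T \o V = id], so
    [`|f| <= N * `|Ta f|]. *)
Lemma continuous_frame_op (T V : {linear H -> H}) D F :
  bounded_operator T -> bounded_operator V -> cancel V T ->
  continuous_frame mu dot D F -> continuous_frame mu dot D (T \o F).
Proof.
move=> Tb Vb VK [mF [A [B [A0 B0 FAB]]]].
have [|_ [B' B'0 FB']] := @bessel_mapping_op T D F Tb.
  by split => //; exists B => // f; case/andP: (FAB f).
have [Ta adj] := adjoint_exists dot_norm Tb.
have [Va adjV] := adjoint_exists dot_norm Vb.
have [N N0 VN] := bounded_operator_rnorm Vb.
have VaN := adjoint_rnorm_le dot_norm adjV (ltW N0) VN.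
have TaK : cancel Ta Va.
  by move=> f; apply: (dot_eqr dot_norm) => h; rewrite -adjV -adj VK.
split; first exact: weakly_measurable_op adj _ _ mF.
exists (A / N ^+ 2), B'; split => //; first by rewrite divr_gt0 ?exprn_gt0.
move=> f; rewrite FB' andbT (sqnorm_int_op adj).
have /andP[+ _] := FAB (Ta f); apply: le_trans; rewrite lee_fin.
rewrite -mulrA ler_pM2l// ler_pdivrMl ?exprn_gt0// -exprMn.
rewrite lerXn2r ?nnegrE ?mulr_ge0 ?rnorm_ge0 ?(ltW N0)//.
by rewrite -{1}(TaK f).
Qed.

(** The lower bound uses [`|v| = `|V (T v)| <= N * `|T v|]. *)
Lemma continuous_riesz_basis_op (T V : {linear H -> H}) D F :
  bounded_operator T -> bounded_operator V -> cancel V T -> cancel T V ->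
  continuous_riesz_basis mu dot D F ->
  continuous_riesz_basis mu dot D (T \o F).
Proof.
move=> Tb Vb VK TK [Fc [A [B [A0 B0 FAB]]]].
split; first exact: mu_complete_op Tb VK Fc.
have [Ta adj] := adjoint_exists dot_norm Tb.
have [M M0 TM] := bounded_operator_rnorm Tb.
have [N N0 VN] := bounded_operator_rnorm Vb.
exists (N^-1 * A), (M * B); split; rewrite ?mulr_gt0 ?invr_gt0//.
move=> phi X1 phiL2 mX1 X1D X1fin.
have [v phiv /andP[Av vB]] := FAB phi X1 phiL2 mX1 X1D X1fin.
exists (T v); first exact: is_weak_integral_scale_op adj _ _ _ _ phiv.
rewrite !EFinM -!muleA; apply/andP; split.
- have N0' : (0 <= N^-1%:E)%E by rewrite lee_fin invr_ge0 ltW.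
  rewrite (le_trans (lee_wpmul2l N0' Av))// -EFinM lee_fin ler_pdivrMl//.
  by rewrite -{1}(TK v).
- have M0' : (0 <= M%:E)%E by rewrite lee_fin ltW.
  by rewrite (le_trans _ (lee_wpmul2l M0' vB))// -EFinM lee_fin.
Qed.

End transport.

Theorem proposition3p4
  (R : realType) (k : scalar_kind)
  (H : completeNormedModType (scalars R k)) (dot : {dot H for @conj R k})
  (dot_norm : forall v : H, dot v v = `|v| ^+ 2)
  (H_separable : separable_space H)
  (d : measure_display) (X : measurableType d)
  (mu : {sigma_finite_measure set X -> \bar R})
  (F : X -> H) (F_near_riesz : continuous_near_riesz_basis mu dot F)
  (U : {linear H -> H}) (U_bounded : bounded_operator U)
  (U_invertible : boundedly_invertible U) :
  continuous_near_riesz_basis mu dot (fun x => U (F x)).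
Proof.
have [V [V_bounded UK VK]] := U_invertible.
have [F_frame [X1 [mX1 X1_fin F_riesz]] F_not_complete] := F_near_riesz.
split.
- exact: continuous_frame_op U_bounded V_bounded VK F_frame.
- exists X1; split => //.
  exact: continuous_riesz_basis_op U_bounded V_bounded VK UK F_riesz.
- move=> muX Y mY Y_fin UF_complete; apply: (F_not_complete muX Y mY Y_fin).
  (* completeness goes back from [U \o F] to [F] along the inverse of [U] *)
  have -> : F = V \o (fun x => U (F x)) by apply/funext => x /=; rewrite UK.
  exact: mu_complete_op V_bounded UK UF_complete.
Qed.
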